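(* Suppose the following statement (A) holds: (A) There are absolute constants $t,k_0$ such that for every integer $k\ge k_0$ and every constant $c>0$ there is $n_0$ such that for all $n\ge n_0$, every graph on $n$ vertices with at least $c\,n^{3/2}$ edges contains (as a subgraph) a copy of some graph $H\in\mathcal{H}_{k,t}$. Then the following statement (B) holds: (B) There is an absolute constant $d$ such that for every integer $e\ge 3$ and every constant $c>0$ there is $n_0$ such that for all $n\ge n_0$, every $3$-uniform hypergraph on $n$ vertices with at least $c\,n^2$ hyperedges contains an $(e+d,e)$-configuration.
   Context: A $3$-uniform hypergraph ($3$-graph) is a set of vertices together with a set of $3$-element subsets (hyperedges). An $(v,e)$-configuration in a $3$-graph is a set of $e$ hyperedges whose union has at most $v$ vertices. A graph $H$ is $2$-degenerate if its vertices can be ordered $v_1,\dots,v_k$ so that each $v_i$ has at most $2$ neighbours among $v_1,\dots,v_{i-1}$. For integers $k,t$, $\mathcal{H}_{k,t}$ denotes the family of $2$-degenerate graphs on $k$ vertices with exactly $2k-t$ edges. *)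

(* Defs.v *)
From mathcomp Require Export all_boot.
From Stdlib Require Export Reals.

Set Implicit Arguments.
Unset Strict Implicit.
Unset Printing Implicit Defensive.

Definition is_graph (n : nat) (E : {set {set 'I_n}}) : Prop :=
  forall A, A \in E -> #|A| = 2.

Definition is_3graph (n : nat) (E : {set {set 'I_n}}) : Prop :=
  forall A, A \in E -> #|A| = 3.

(* 2-degenerate: there is an ordering (given by the injective, hence bijective, position map [ord]) such
   that every vertex has at most 2 neighbours that come earlier. *)
Definition two_degenerate (k : nat) (H : {set {set 'I_k}}) : Prop :=
  exists ord : 'I_k -> 'I_k, injective ord /\
    forall v : 'I_k,
      #|[set u : 'I_k | ([set u; v] \in H) && (ord u < ord v)%N]| <= 2.

(* H belongs to the family H_{k,t}: 2-degenerate graph on k vertices with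
   exactly 2k - t edges (written #|H| + t = 2k to avoid truncated subtraction). *)
Definition in_Hkt (k t : nat) (H : {set {set 'I_k}}) : Prop :=
  is_graph H /\ two_degenerate H /\ (#|H| + t = 2 * k)%N.

Definition contains_copy (k n : nat) (H : {set {set 'I_k}}) (G : {set {set 'I_n}}) : Prop :=
  exists f : 'I_k -> 'I_n, injective f /\ forall A, A \in H -> f @: A \in G.

Definition has_config (v e n : nat) (E : {set {set 'I_n}}) : Prop :=
  exists F : {set {set 'I_n}}, F \subset E /\ #|F| = e /\
    (#|\bigcup_(A in F) A| <= v)%N.

(* Main.v *)
(** If some pair of vertices lies in [e] hyperedges, these form an
    [(e + 2, e)]-configuration; otherwise a maximal linear subsystem [L] keeps a
    positive proportion of the hyperedges.  Join two pairs of vertices [(a, b)]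
    and [(a', b')] when [{a, a', z}] and [{b, b', z}] are distinct hyperedges of
    [L] for some [z].  By Cauchy-Schwarz over [z] this graph on [N = n^2]
    vertices has at least a constant times [n^3 = N^(3/2)] edges, so it contains
    some [H] in [H_{k,t}].  Revealing the vertices of [H] in degenerate order, a
    vertex with two back edges brings at most as many new vertices of the
    3-graph as new hyperedges, and each missing back edge costs at most one
    vertex, [t] in total.  Each step uses at most 4 new hyperedges, so stopping
    as soon as [e] hyperedges are present leaves at most [e + 3 + t] vertices;
    the process does reach [e] hyperedges since [k] distinct pairs cannot all
    live on [e + t] vertices once [k > (e + t)^2]. *)

Require Import Defs.
From mathcomp Require Import all_boot zify.
From Stdlib Require Import Reals Lra.

Set Implicit Arguments.
Unset Strict Implicit.
Unset Printing Implicit Defensive.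

(** * Counting in finite sets *)

Lemma exists_subset_card (T : finType) (A : {set T}) m :
  m <= #|A| -> exists2 B : {set T}, B \subset A & #|B| = m.
Proof.
case/card_geqP=> s [us <- sA]; exists [set:: s]; last by rewrite cardsE; apply/card_uniqP.
by apply/subsetP=> x; rewrite inE => /sA.
Qed.

Lemma leq_sum_sub (I : finType) (P : pred I) (F : I -> nat) :
  \sum_(i | P i) F i <= \sum_i F i.
Proof. by rewrite [leqRHS](bigID P) leq_addr. Qed.

Lemma leq_card_bigcup (I T : finType) (P : pred I) (F : I -> {set T}) :
  #|\bigcup_(i | P i) F i| <= \sum_(i | P i) #|F i|.
Proof.
elim/big_rec2: _ => [|i m U _ le]; first by rewrite cards0.
by apply: leq_trans (leq_card_setU _ _) _; rewrite leq_add2l.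
Qed.

(** Cauchy-Schwarz, by summing [2 a_i a_j <= a_i^2 + a_j^2] over all [i] and [j]. *)
Lemma sum_sqr_le (I : finType) (a : I -> nat) :
  (\sum_i a i) * (\sum_i a i) <= #|I| * \sum_i a i * a i.
Proof.
rewrite -(@leq_pmul2l 2) // big_distrlr /= big_distrr /=.
apply: (@leq_trans (\sum_i \sum_j (a i * a i + a j * a j))).
  apply: leq_sum => i _; rewrite big_distrr /=; apply: leq_sum => j _.
  by rewrite !mulnn; apply: (nat_Cauchy (a i) (a j)).1.
under eq_bigr do rewrite big_split /= sum_nat_const.
by rewrite big_split /= -big_distrr /= sum_nat_const mul2n addnn.
Qed.

Lemma card_dep_pairs (I T : finType) (F : I -> {set T}) :
  #|[set q : I * T | q.2 \in F q.1]| = \sum_i #|F i|.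
Proof.
rewrite -sum1_card; under [RHS]eq_bigr do rewrite -sum1_card.
by rewrite pair_big_dep; apply: eq_bigl => q; rewrite inE.
Qed.

(** * Adding one pair to a configuration in a linear system *)

Section LinearSystems.

Variables (V : finType) (L : {set {set V}}).
Hypothesis L3 : forall A, A \in L -> #|A| = 3.
Hypothesis Llin : forall A B, A \in L -> B \in L -> 2 <= #|A :&: B| -> A = B.

Lemma linear_eq A B x y : A \in L -> B \in L -> x != y ->
  x \in A -> y \in A -> x \in B -> y \in B -> A = B.
Proof.
move=> LA LB nxy xA yA xB yB; apply: Llin => //.
have <- : #|[set x; y]| = 2 by rewrite cards2 nxy.
apply: subset_leq_card; apply/subsetP=> w.
by rewrite !inE => /orP[] /eqP->; rewrite ?xA ?yA ?xB ?yB.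
Qed.

Lemma triple_neq x y z : [set x; y; z] \in L -> [/\ x != y, x != z & y != z].
Proof.
move/L3; rewrite setUC cardsU1 cards2 !inE negb_or.
by rewrite [z == x]eq_sym [z == y]eq_sym; do !case: eqP.
Qed.

(** [S] may exceed the union of [F]: it also holds coordinates of revealed pairs that lie on no
    chosen hyperedge. *)
Definition covers (F : {set {set V}}) (S : {set V}) :=
  F \subset L /\ forall A, A \in F -> A \subset S.

(* The vertices of [w] can be added to [S] at a net cost (new vertices minus new
   hyperedges) of at most [r]. *)
Definition extends (F : {set {set V}}) (S : {set V}) (w : V * V) (r : nat) :=
  exists F' S', [/\ covers F' S', S \subset S', (w.1 \in S') && (w.2 \in S'),
    #|F'| <= #|F| + 4 & #|S'| + #|F| <= #|S| + #|F'| + r].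

(** A hyperedge not inside [S] is not in [F], so exactly [size s] hyperedges are gained; [t] may
    meet [S] or repeat vertices, since only an upper bound on the new vertices matters. *)
Lemma extends_by F S (w : V * V) r (s : seq {set V}) (t : seq V) :
  covers F S -> uniq s -> size s <= 4 -> size t <= size s + r ->
  all (fun A : {set V} => [&& A \in L, ~~ (A \subset S) & A \subset S :|: [set:: t]]) s ->
  w.1 \in S :|: [set:: t] -> w.2 \in S :|: [set:: t] ->
  extends F S w r.
Proof.
move=> [FL FS] us s4 st /allP sP w1 w2; exists (F :|: [set:: s]), (S :|: [set:: t]).
have cs : #|F :|: [set:: s]| = #|F| + size s.
  have /card_uniqP <- := us; rewrite cardsU (_ : F :&: _ = set0) ?cards0 ?subn0.
    by rewrite cardsE.
  apply/setP=> A; rewrite !inE; apply/negP=> /andP[/FS AS /sP/and3P[_]].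
  by rewrite AS.
have ct : #|S :|: [set:: t]| <= #|S| + size t.
  apply: leq_trans (leq_card_setU _ _) _; rewrite leq_add2l cardsE.
  exact: card_size.
split; rewrite ?subsetUl ?w1 ?w2 ?cs ?leq_add2l //; last by lia.
split=> [|A]; first by apply/subsetP=> A; rewrite !inE => /orP[/(subsetP FL)//|/sP/and3P[]].
rewrite !inE => /orP[/FS AS|/sP/and3P[]//].
exact: subset_trans AS (subsetUl _ _).
Qed.

Definition glued (z : V) (u v : V * V) :=
  [&& [set u.1; v.1; z] \in L, [set u.2; v.2; z] \in L
    & [set u.1; v.1; z] != [set u.2; v.2; z]].

Lemma triple_sub x y z (S : {set V}) :
  ([set x; y; z] \subset S) = [&& x \in S, y \in S & z \in S].
Proof. by rewrite !subUset !sub1set andbA. Qed.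

Lemma extends0 F S w : covers F S -> extends F S w 2.
Proof.
move=> C; apply: (extends_by (s := [::]) (t := [:: w.1; w.2])) => //;
by rewrite !inE eqxx ?orbT.
Qed.

Lemma neq_mem (A B : {set V}) x : x \in A -> x \notin B -> (A == B) = false.
Proof. by move=> xA; apply: contraNF => /eqP <-. Qed.


(** A new apex [z] brings two hyperedges for [a], [b], [z]. With [z] old, a new [a] is paid for by
    its hyperedge and only [b] is unpaid. *)
Lemma extends1 F S w u z : covers F S -> glued z w u ->
  (u.1 \in S) && (u.2 \in S) -> extends F S w 1.
Proof.
move: w u => [a b] [a1 b1] C /= /and3P[/= P1 Q1 /negPf PQ1] /andP[Sa1 Sb1].
have fin (s : seq {set V}) (t : seq V) := @extends_by F S (a, b) 1 s t C.
have [Sz|Sz] := boolP (z \in S); last first.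
  by apply: (fin [:: [set a; a1; z]; [set b; b1; z]] [:: a; b; z]);
    rewrite /= ?triple_sub ?inE ?PQ1 ?P1 ?Q1 ?Sa1 ?Sb1 ?(negPf Sz) ?eqxx ?orbT ?andbF.
have [Sa|Sa] := boolP (a \in S); last first.
  by apply: (fin [:: [set a; a1; z]] [:: a; b]);
    rewrite /= ?triple_sub ?inE ?P1 ?Sa1 ?Sb1 ?Sz ?(negPf Sa) ?eqxx ?orbT ?andbF.
by apply: (fin [::] [:: b]); rewrite /= ?triple_sub ?inE ?Sa ?eqxx ?orbT.
Qed.

(** The two hyperedges through the new apex [z1] pay for [z1] and [b]; a new [a] is paid for by
    [[set a; a2; z2]], whose other vertices are old. *)
Lemma extends2_half F S w u1 u2 z1 z2 : covers F S ->
  glued z1 w u1 -> glued z2 w u2 ->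
  (u1.1 \in S) && (u1.2 \in S) -> (u2.1 \in S) && (u2.2 \in S) ->
  z1 \notin S -> z2 \in S -> extends F S w 0.
Proof.
move: w u1 u2 => [a b] [a1 b1] [a2 b2] C /=.
move=> /and3P[/= P1 Q1 /negPf PQ1] /and3P[/= P2 _ _].
move=> /andP[Sa1 Sb1] /andP[Sa2 Sb2] Sz1 Sz2.
have [_ az1 _] := triple_neq P1.
have fin (s : seq {set V}) (t : seq V) := @extends_by F S (a, b) 0 s t C.
have [Sa|Sa] := boolP (a \in S).
  by apply: (fin [:: [set a; a1; z1]; [set b; b1; z1]] [:: b; z1]);
    rewrite /= ?triple_sub ?inE ?PQ1 ?P1 ?Q1 ?Sa1 ?Sb1 ?(negPf Sz1) ?Sa ?eqxx
      ?orbT ?andbF.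
have z1E2 : z1 \notin [set a; a2; z2].
  rewrite !inE !negb_or eq_sym az1 !(contraNneq _ Sz1) //.
  - by move=> ->.
  - by move=> ->.
by apply: (fin [:: [set a; a1; z1]; [set b; b1; z1]; [set a; a2; z2]] [:: a; b; z1]);
  rewrite /= ?triple_sub ?(neq_mem _ z1E2) ?inE ?(neq_mem _ z1E2) ?inE
    ?PQ1 ?P1 ?Q1 ?P2 ?Sa1 ?Sb1 ?Sa2 ?Sz2 ?(negPf Sz1) ?(negPf Sa)
    ?eqxx ?orbT ?andbF.
Qed.

(** If both apexes are old, each new coordinate is paid for by its hyperedge through [z1]. If both
    are new, they are distinct and four hyperedges pay for [a], [b], [z1], [z2]. *)
Lemma extends2 F S w u1 u2 z1 z2 : covers F S ->
  glued z1 w u1 -> glued z2 w u2 -> u1 != u2 ->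
  (u1.1 \in S) && (u1.2 \in S) -> (u2.1 \in S) && (u2.2 \in S) ->
  extends F S w 0.
Proof.
move=> C g1 g2 nu Su1 Su2.
have [Sz1|Sz1] := boolP (z1 \in S); have [Sz2|Sz2] := boolP (z2 \in S);
  [ | exact: extends2_half C g2 g1 Su2 Su1 Sz2 Sz1
    | exact: extends2_half C g1 g2 Su1 Su2 Sz1 Sz2 |];
move: w u1 u2 C g1 g2 nu Su1 Su2 => [a b] [a1 b1] [a2 b2] C /=;
move=> /and3P[/= P1 Q1 /negPf PQ1] /and3P[/= P2 Q2 /negPf PQ2] nu;
move=> /andP[Sa1 Sb1] /andP[Sa2 Sb2];
have fin (s : seq {set V}) (t : seq V) := @extends_by F S (a, b) 0 s t C.
- have [Sa|Sa] := boolP (a \in S); have [Sb|Sb] := boolP (b \in S).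
  + by apply: (fin [::] [::]); rewrite /= ?inE ?Sa ?Sb.
  + by apply: (fin [:: [set b; b1; z1]] [:: b]);
      rewrite /= ?triple_sub ?inE ?Q1 ?Sb1 ?Sz1 ?Sa ?(negPf Sb) ?eqxx ?orbT.
  + by apply: (fin [:: [set a; a1; z1]] [:: a]);
      rewrite /= ?triple_sub ?inE ?P1 ?Sa1 ?Sz1 ?Sb ?(negPf Sa) ?eqxx ?orbT.
  + by apply: (fin [:: [set a; a1; z1]; [set b; b1; z1]] [:: a; b]);
      rewrite /= ?triple_sub ?inE ?P1 ?Q1 ?PQ1 ?Sa1 ?Sb1 ?Sz1 ?(negPf Sb)
        ?(negPf Sa) ?eqxx ?orbT.
have [aa1 az1 a1z1] := triple_neq P1; have [bb1 bz1 b1z1] := triple_neq Q1.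
have [/eqP ez|nz] := boolP (z1 == z2).
  (* By linearity a common new apex would force [u1 = u2]. *)
  subst z2; case/eqP: nu.
  have eP : [set a; a1; z1] = [set a; a2; z1].
    by apply: (linear_eq P1 P2 az1); rewrite !inE eqxx ?orbT.
  have eQ : [set b; b1; z1] = [set b; b2; z1].
    by apply: (linear_eq Q1 Q2 bz1); rewrite !inE eqxx ?orbT.
  have: a1 \in [set a; a2; z1] by rewrite -eP !inE eqxx orbT.
  have: b1 \in [set b; b2; z1] by rewrite -eQ !inE eqxx orbT.
  rewrite !inE (negPf a1z1) (negPf b1z1) [a1 == a]eq_sym [b1 == b]eq_sym.
  by rewrite (negPf aa1) (negPf bb1) /= !orbF => /eqP-> /eqP->.
(* Containing [z1] separates the hyperedges of the first edge from those of the second. *)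
have notin x y : x != z1 -> y \in S -> z1 \notin [set x; y; z2].
  rewrite eq_sym !inE !negb_or nz andbT => -> yS /=.
  by apply: contraNneq Sz1 => ->.
have z1E2 := notin _ _ az1 Sa2; have z1D2 := notin _ _ bz1 Sb2.
by apply: (fin [:: [set a; a1; z1]; [set b; b1; z1]; [set a; a2; z2]; [set b; b2; z2]]
    [:: a; b; z1; z2]);
  rewrite /= ?triple_sub ?inE ?PQ1 ?PQ2 ?(neq_mem _ z1E2) ?(neq_mem _ z1D2)
    ?inE ?P1 ?Q1 ?P2 ?Q2 ?Sa1 ?Sb1 ?Sa2 ?Sb2 ?(negPf Sz1) ?(negPf Sz2)
    ?eqxx ?orbT ?andbF.
Qed.

(** * The auxiliary graph on pairs, revealed in degenerate order *)

Lemma glued_sym z u v : glued z u v = glued z v u.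
Proof. by rewrite /glued [[set u.1; v.1]]setUC [[set u.2; v.2]]setUC. Qed.

Lemma glued_neq z u v : glued z u v -> u != v.
Proof.
case/and3P=> /triple_neq[n1 _ _] _ _.
by apply: contraNneq n1 => ->.
Qed.

Definition glued_pairs := [set q : (V * V) * (V * V) | [exists z, glued z q.1 q.2]].

Definition glued_graph := [set [set q.1; q.2] | q in glued_pairs].

Lemma glued_graphP u v : [set u; v] \in glued_graph -> exists z, glued z u v.
Proof.
case/imsetP=> [[x y]]; rewrite inE /= => /existsP[z g] e; exists z.
have nxy := glued_neq g.
have: x \in [set u; v] by rewrite e !inE eqxx.
have: y \in [set u; v] by rewrite e !inE eqxx orbT.
rewrite !inE => /orP[]/eqP ey /orP[]/eqP ex; subst x y => //.
- by rewrite eqxx in nxy.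
- by rewrite glued_sym.
- by rewrite eqxx in nxy.
Qed.

Lemma glued_graph_card A : A \in glued_graph -> #|A| = 2.
Proof.
by case/imsetP=> [[x y]]; rewrite inE => /existsP[z /glued_neq g] ->; rewrite cards2 g.
Qed.

Definition back k (H : {set {set 'I_k}}) (ord : 'I_k -> 'I_k) v :=
  [set u : 'I_k | ([set u; v] \in H) && (ord u < ord v)].

(** Every edge is counted at its later endpoint. *)
Lemma leq_card_back k (H : {set {set 'I_k}}) (ord : 'I_k -> 'I_k) :
  injective ord -> is_graph H -> #|H| <= \sum_v #|back H ord v|.
Proof.
move=> oI gH.
have sub : H \subset \bigcup_v [set [set u; v] | u in back H ord v].
  apply/subsetP=> A HA; have /eqP/cards2P[x [y [nxy eA]]] := gH _ HA.
  have : ord x != ord y by apply: contraNneq nxy => /oI->.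
  rewrite neq_ltn => /orP[lt|lt]; apply/bigcupP.
    by exists y => //; apply/imsetP; exists x; rewrite ?inE -?eA ?HA.
  by exists x => //; apply/imsetP; exists y; rewrite ?inE setUC -eA ?HA.
apply: leq_trans (subset_leq_card sub) _; apply: leq_trans (leq_card_bigcup _ _) _.
by apply: leq_sum => v _; apply: leq_imset_card.
Qed.

Lemma extends_back k (H : {set {set 'I_k}}) (ord : 'I_k -> 'I_k) (f : 'I_k -> V * V) v F S :
  injective f -> (forall A, A \in H -> f @: A \in glued_graph) ->
  #|back H ord v| <= 2 -> covers F S ->
  (forall u, ord u < ord v -> ((f u).1 \in S) && ((f u).2 \in S)) ->
  extends F S (f v) (2 - #|back H ord v|).
Proof.
move=> fI fH b2 C old.
have nb u : u \in back H ord v ->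
    (exists z, glued z (f v) (f u)) /\ ((f u).1 \in S) && ((f u).2 \in S).
  rewrite inE => /andP[/fH]; rewrite imsetU !imset_set1 setUC.
  by move=> /glued_graphP g /old.
case cb: #|_| b2 => [|[|[|//]]] _.
- by apply: extends0.
- have /eqP/cards1P[u eb] := cb.
  have [[z g] Su] := nb u ltac:(by rewrite eb set11).
  exact: extends1 C g Su.
have /eqP/cards2P[u1 [u2 [nu eb]]] := cb.
have [|[z1 g1] S1] := nb u1; first by rewrite eb !inE eqxx.
have [|[z2 g2] S2] := nb u2; first by rewrite eb !inE eqxx orbT.
by apply: extends2 C g1 g2 _ S1 S2; apply: contraNneq nu => /fI->.
Qed.

Lemma exists_config_of_copy k t e (H : {set {set 'I_k}}) (f : 'I_k -> V * V) :
  0 < e -> (e + t) * (e + t) < k -> in_Hkt t H -> injective f ->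
  (forall A, A \in H -> f @: A \in glued_graph) ->
  exists F : {set {set V}}, [/\ F \subset L, #|F| = e & #|\bigcup_(A in F) A| <= e + (t + 3)].
Proof.
move=> e0 kbig [gH [[ord [oI b2]] cH]] fI fH.
have {}b2 v : #|back H ord v| <= 2 by exact: b2.
(* The deficits sum to [2 * k] minus the number of back edges, which is at least [#|H|], that is
   [2 * k - t]. *)
have deficit : \sum_v (2 - #|back H ord v|) <= t.
  have lb := leq_card_back oI gH.
  have : \sum_v (2 - #|back H ord v|) + \sum_v #|back H ord v| = 2 * k.
    rewrite -big_split /= (eq_bigr (fun=> 2)) => [|v _]; last by rewrite subnK.
    by rewrite sum_nat_const card_ord mulnC.
  by move: lb cH; lia.
set goal := exists F, _.
(* Either the target has been reached within the first [j] vertices, or the excess of vertices over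
   hyperedges is at most their total deficit. *)
have prefix j : j <= k -> goal \/ exists F S,
    [/\ covers F S, #|F| < e,
        forall u, ord u < j -> ((f u).1 \in S) && ((f u).2 \in S)
      & #|S| <= #|F| + \sum_(v | ord v < j) (2 - #|back H ord v|)].
  elim: j => [|j IHj] jk.
    right; exists set0, set0; split; rewrite ?cards0 //.
    by split=> [|A]; rewrite ?sub0set // inE.
  have [|[F [S [C Fe old cS]]]] := IHj (ltnW jk); first by left.
  have [g oK gK] := injF_bij oI.
  pose v := g (Ordinal jk); have ov : ord v = j :> nat by rewrite gK.
  have sumj : \sum_(u | ord u < j.+1) (2 - #|back H ord u|) =
      2 - #|back H ord v| + \sum_(u | ord u < j) (2 - #|back H ord u|).
    rewrite (bigD1 v) /= ?ov //; congr (_ + _); apply: eq_bigl => u.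
    have [->|nuv] := eqVneq u v; first by rewrite ov ltnn andbF.
    rewrite andbT ltnS leq_eqVlt; case: eqP => //= eu; case/eqP: nuv.
    by apply/oI/val_inj; rewrite /= eu ov.
  have old' u : ord u < ord v -> ((f u).1 \in S) && ((f u).2 \in S).
    by rewrite ov; apply: old.
  have [F' [S' [C' SS' fv cF' cS']]] := extends_back fI fH (b2 v) C old'.
  have cS'' : #|S'| <= #|F'| + \sum_(u | ord u < j.+1) (2 - #|back H ord u|).
    by rewrite sumj; move: cS cS'; lia.
  have [F'e|eF'] := ltnP #|F'| e.
    right; exists F', S'; split => // u; rewrite ltnS leq_eqVlt => /orP[/eqP eu|/old].
      by rewrite (_ : u = v) //; apply/oI/val_inj; rewrite /= eu ov.
    by case/andP=> /(subsetP SS')-> /(subsetP SS')->.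
  (* Since [#|F| < e] before this step, [#|F'| <= e + 3], and [S'] bounds the union of any [e]
     members of [F']. *)
  left; have [F0 F0F' cF0] := exists_subset_card eF'.
  exists F0; split=> //; first exact: subset_trans F0F' C'.1.
  have cov : \bigcup_(A in F0) A \subset S'.
    by apply/bigcupsP=> A /(subsetP F0F')/(C'.2).
  have := leq_trans (leq_sum_sub (fun v => ord v < j.+1) _) deficit.
  by move: (subset_leq_card cov) cS'' cF' Fe; lia.
have [//|[F [S [C Fe old cS]]]] := prefix k (leqnn k).
have cS' : #|S| <= e + t.
  apply: leq_trans cS _; apply: leq_add; first exact: ltnW.
  exact: leq_trans (leq_sum_sub _ _) deficit.
(* All [k] distinct images lie in [setX S S], which is too small. *)
suff : k <= #|S| * #|S| by move: kbig; have := leq_mul cS' cS'; lia.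
rewrite -cardsX -[leqLHS]card_ord -cardsT -(card_imset _ fI).
apply: subset_leq_card; apply/subsetP=> _ /imsetP[u _ ->].
by rewrite !inE; apply: old.
Qed.

(** * Edge density of the auxiliary graph *)

Definition link z := [set p : V * V | [set p.1; p.2; z] \in L].

Lemma card_le_sum_link : #|L| <= \sum_z #|link z|.
Proof.
rewrite -card_dep_pairs.
apply: leq_trans (leq_imset_card (fun q : V * (V * V) => [set q.2.1; q.2.2; q.1]) _).
apply: subset_leq_card; apply/subsetP=> A LA.
have A3 := L3 LA; have /card_gt0P[z zA] : 0 < #|A| by rewrite A3.
have /eqP/cards2P[x [y [_ eA]]] : #|A :\ z| = 2.
  by move: A3; rewrite (cardsD1 z) zA => -[].
have defA : A = [set x; y; z] by rewrite -eA setUC setD1K.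
by apply/imsetP; exists (z, (x, y)); rewrite // !inE /= -defA.
Qed.

Definition link_pairs z :=
  [set r : (V * V) * (V * V) | [&& r.1 \in link z, r.2 \in link z
     & [set r.1.1; r.1.2; z] != [set r.2.1; r.2.2; z]]].

(** Two ordered pairs in the link of [z] give the same hyperedge only if they are equal or swapped;
    the boolean argument of [g] tells which. *)
Lemma sqr_card_link z : #|link z| * #|link z| <= #|link_pairs z| + 2 * #|link z|.
Proof.
pose g (s : (V * V) * bool) := (s.1, if s.2 then s.1 else (s.1.2, s.1.1)).
have sub : setX (link z) (link z) \subset
    link_pairs z :|: [set g s | s in setX (link z) [set: bool]].
  apply/subsetP=> [[[a a'] [b b']]]; rewrite !inE /= => /andP[P Q].
  rewrite P Q /=; case: eqP => //= e; apply/imsetP.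
  have [aa' az a'z] := triple_neq P; have [bb' bz b'z] := triple_neq Q.
  have : a \in [set b; b'; z] by rewrite -e !inE eqxx.
  have : a' \in [set b; b'; z] by rewrite -e !inE eqxx orbT.
  rewrite !inE (negPf az) (negPf a'z) !orbF => /orP[]/eqP ea' /orP[]/eqP ea; subst a a'.
  - by rewrite eqxx in aa'.
  - by exists ((b', b), false); rewrite ?inE /= ?P.
  - by exists ((b, b'), true); rewrite ?inE /= ?P.
  - by rewrite eqxx in aa'.
rewrite -cardsX; apply: leq_trans (subset_leq_card sub) _.
apply: leq_trans (leq_card_setU _ _) _; rewrite leq_add2l.
apply: leq_trans (leq_imset_card _ _) _.
by rewrite cardsX cardsT card_bool mulnC.
Qed.

(** Regrouping coordinates by [g] forgets [z], but linearity recovers it: [a] and [a'] determine the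
    hyperedge. *)
Lemma sum_link_pairs_le : \sum_z #|link_pairs z| <= #|glued_pairs|.
Proof.
rewrite -card_dep_pairs.
pose g (s : V * ((V * V) * (V * V))) :=
  ((s.2.1.1, s.2.2.1), (s.2.1.2, s.2.2.2)).
rewrite -(@card_in_imset _ _ g).
  apply: subset_leq_card; apply/subsetP=> _ /imsetP[[z [[a a'] [b b']]] + ->].
  by rewrite !inE /= => /and3P[P Q PQ]; apply/existsP; exists z; apply/and3P.
move=> [z [[a a'] [b b']]] [w [[c c'] [d d']]]; rewrite !inE /= => /andP[P _] /andP[P' _].
case=> ? ? ? ?; subst c d c' d'; congr (_, _).
have [n1 n2 n3] := triple_neq P.
have e : [set a; a'; z] = [set a; a'; w].
  by apply: (linear_eq P P' n1); rewrite !inE eqxx ?orbT.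
have : z \in [set a; a'; w] by rewrite -e !inE eqxx orbT.
by rewrite !inE [z == a]eq_sym [z == a']eq_sym (negPf n2) (negPf n3) => /eqP.
Qed.

Lemma card_glued_pairs : #|glued_pairs| <= #|glued_graph| * 4.
Proof.
apply: (@leq_trans #|\bigcup_(A in glued_graph) setX A A|).
  apply: subset_leq_card; apply/subsetP=> [[u v] uv]; apply/bigcupP.
  by exists [set u; v]; [apply/imsetP; exists (u, v) | rewrite !inE !eqxx orbT].
apply: leq_trans (leq_card_bigcup _ _) _.
rewrite -sum_nat_const; apply: leq_sum => A GA.
by rewrite cardsX (glued_graph_card GA).
Qed.

(** [X] is the total size of the links, to which Cauchy-Schwarz applies. *)
Lemma glued_graph_dense : exists X, #|L| <= X /\
  X * X <= #|V| * (#|glued_graph| * 4 + 2 * X).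
Proof.
exists (\sum_z #|link z|); split; first exact: card_le_sum_link.
apply: leq_trans (sum_sqr_le _) _; rewrite leq_mul2l; apply/orP; right.
apply: (@leq_trans (\sum_z (#|link_pairs z| + 2 * #|link z|))).
  by apply: leq_sum => z _; apply: sqr_card_link.
rewrite big_split -big_distrr leq_add2r.
exact: leq_trans sum_link_pairs_le card_glued_pairs.
Qed.

End LinearSystems.

(** * Reduction to linear systems *)

(** Take [L] maximal. Every hyperedge then contains two vertices of some member of [L]; there are at
    most [3 * #|L|] such pairs, each in at most [e] hyperedges. *)
Lemma exists_linear_subsystem (V : finType) (E : {set {set V}}) e :
  (forall A, A \in E -> #|A| = 3) ->
  (forall p : {set V}, #|p| = 2 -> #|[set B in E | p \subset B]| <= e) ->
  exists L : {set {set V}}, [/\ L \subset E, #|E| <= #|L| * (3 * e)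
    & forall A B, A \in L -> B \in L -> 2 <= #|A :&: B| -> A = B].
Proof.
move=> E3 codeg.
pose lin (L : {set {set V}}) := (L \subset E) &&
  [forall A in L, forall B in L, (2 <= #|A :&: B|) ==> (A == B)].
have lin0 : lin set0.
  by rewrite /lin sub0set; apply/forall_inP=> A; rewrite inE.
have [L /maxsetP[/andP[LE /forall_inP Llin] Lmax] _] := maxset_exists lin0.
exists L; split=> // [|A B LA LB cAB]; last first.
  by apply/eqP; have /forall_inP/(_ _ LB)/implyP := Llin _ LA; apply.
have meet B : B \in E -> exists2 A, A \in L & 2 <= #|A :&: B|.
  move=> EB; have [LB|nLB] := boolP (B \in L).
    by exists B; rewrite // setIid E3.
  have [/exists_inP //|none] := boolP [exists A in L, 2 <= #|A :&: B|].
  have nm A : A \in L -> (2 <= #|A :&: B|) = false.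
    by move=> LA; apply: contraNF none => h; apply/exists_inP; exists A.
  case/negP: nLB; rewrite -(Lmax (B |: L)) ?setU11 ?subsetUr // /lin.
  apply/andP; split; first by rewrite subUset sub1set EB LE.
  apply/forall_inP=> A /setU1P[->|LA]; apply/forall_inP=> C /setU1P[->|LC].
  - by rewrite eqxx implybT.
  - by rewrite setIC nm.
  - by rewrite nm.
  - by have /forall_inP/(_ _ LC) := Llin _ LA.
pose near (A : {set V}) := \bigcup_(x in A) [set B in E | A :\ x \subset B].
have sub : E \subset \bigcup_(A in L) near A.
  apply/subsetP=> B EB; have [A LA cAB] := meet B EB.
  apply/bigcupP; exists A => //.
  have A3 : #|A| = 3 by rewrite E3 // (subsetP LE).
  have [AB|] := boolP (A \subset B).
    have /card_gt0P[x xA] : 0 < #|A| by rewrite A3.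
    apply/bigcupP; exists x; rewrite // inE EB.
    exact: subset_trans (subsetDl _ _) AB.
  case/subsetPn=> x xA xB; apply/bigcupP; exists x; rewrite // inE EB /=.
  have /eqP <- : A :&: B == A :\ x; last exact: subsetIr.
  have cAx : #|A :\ x| = 2 by move: A3; rewrite (cardsD1 x) xA => -[].
  rewrite eqEcard cAx cAB andbT.
  apply/subsetP=> y; rewrite !inE => /andP[-> yB]; rewrite andbT.
  by apply: contraNneq xB => <-.
apply: leq_trans (subset_leq_card sub) _; apply: leq_trans (leq_card_bigcup _ _) _.
rewrite -sum_nat_const; apply: leq_sum => A LA.
have A3 : #|A| = 3 by rewrite E3 // (subsetP LE).
apply: leq_trans (leq_card_bigcup _ _) _; rewrite -A3 -sum_nat_const.
apply: leq_sum => x xA; apply: codeg.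
by move: A3; rewrite (cardsD1 x) xA => -[].
Qed.

(** Each hyperedge through [p] has one vertex outside [p]. *)
Lemma config_of_codegree n e (E : {set {set 'I_n}}) (p : {set 'I_n}) :
  is_3graph E -> #|p| = 2 -> e <= #|[set B in E | p \subset B]| -> has_config (e + 2) e E.
Proof.
move=> E3 p2 /exists_subset_card[F FE cF]; exists F.
have FP B : B \in F -> [/\ B \in E & p \subset B].
  by move/(subsetP FE); rewrite inE => /andP[].
split; [by apply/subsetP=> B /FP[] | split=> //].
have sub : \bigcup_(B in F) B \subset p :|: \bigcup_(B in F) (B :\: p).
  apply/subsetP=> x /bigcupP[B FB xB]; rewrite inE.
  have [//|xp] := boolP (x \in p); apply/bigcupP; exists B => //.
  by rewrite inE xp.
apply: leq_trans (subset_leq_card sub) _; apply: leq_trans (leq_card_setU _ _) _.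
rewrite p2 addnC leq_add2r; apply: leq_trans (leq_card_bigcup _ _) _.
rewrite -cF -sum1_card; apply: leq_sum => B /FP[/E3 B3 pB].
by rewrite cardsD (setIidPr pB) B3 p2.
Qed.

(** * Transfer to ordinals, real estimates and assembly *)

Lemma contains_copy_finType (T : finType) k (H : {set {set 'I_k}}) (G : {set {set T}}) :
  contains_copy H [set enum_rank @: (A : {set T}) | A in G] ->
  exists2 f : 'I_k -> T, injective f & forall A, A \in H -> f @: A \in G.
Proof.
case=> f [fI fH]; exists (enum_val \o f).
  exact: inj_comp enum_val_inj fI.
move=> A /fH /imsetP[B GB e]; rewrite imset_comp e -imset_comp.
rewrite (eq_imset _ (g := fun x => x)) ?imset_id // => x.
exact: enum_rankK.
Qed.

Lemma has_config_le v v' e n (E : {set {set 'I_n}}) :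
  v <= v' -> has_config v e E -> has_config v' e E.
Proof. by move=> vv' [F [FE [cF cov]]]; exists F; do !split=> //; apply: leq_trans vv'. Qed.

Lemma cubic_lower_bound (c n x g : R) : (0 < c)%R -> (1 <= n)%R -> (4 <= c * n)%R ->
  (c * (n * n) <= x)%R -> (x * x <= n * (g * 4 + 2 * x))%R ->
  (g >= c * c / 8 * (n * n) * n)%R.
Proof.
move=> c0 n1 cn lx up.
(* This product expresses that [x * x - 2 * n * x] is at least its value at [c * n^2], so [x] can be
   replaced by that bound. *)
have h1 : (0 <= (x - c * (n * n)) * (x - 2 * n + c * (n * n)))%R.
  by apply: Rmult_le_pos; nra.
have h2 : (c * c * (n * n * (n * n)) <= n * (g * 4 + 2 * (c * (n * n))))%R by nra.
have h3 : (c * c * (n * (n * n)) <= g * 4 + 2 * (c * (n * n)))%R.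
  by apply: (Rmult_le_reg_l n); nra.
(* As [c * n >= 4], the error [2 * c * n^2] is at most half of [c^2 * n^3]; this yields the constant
   [1 / 8]. *)
have h4 : (0 <= c * (n * n) * (c * n - 4))%R.
  by apply: Rmult_le_pos; nra.
by nra.
Qed.

Theorem theorem1p4 :
  (exists t k0 : nat, forall k : nat, (k0 <= k)%N ->
     forall c : R, (0 < c)%R -> exists n0 : nat, forall n : nat, (n0 <= n)%N ->
       forall G : {set {set 'I_n}}, is_graph G ->
         (INR #|G| >= c * INR n * sqrt (INR n))%R ->
         exists H : {set {set 'I_k}}, in_Hkt t H /\ contains_copy H G) ->
  (exists d : nat, forall e : nat, (3 <= e)%N ->
     forall c : R, (0 < c)%R -> exists n0 : nat, forall n : nat, (n0 <= n)%N ->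
       forall E : {set {set 'I_n}}, is_3graph E ->
         (INR #|E| >= c * INR n ^ 2)%R ->
         has_config (e + d) e E).
Proof.
(* In [t + 3], [t] pays for missing back edges and [3] for overshooting [e] in the last step. *)
case=> t [k0 turan]; exists (t + 3) => e e3 c c0.
pose k := k0 + ((e + t) * (e + t)).+1.
have e3R : (0 < INR (3 * e))%R by apply: lt_0_INR; lia.
(* Density kept by the linear subsystem. *)
pose c1 := (c / INR (3 * e))%R.
have c10 : (0 < c1)%R by apply: Rdiv_lt_0_compat.
have [|n0 copy] := turan k (leq_addr _ _) (c1 * c1 / 8)%R; first by nra.
(* [n1] secures [c1 * n >= 4]. *)
have [n1 n1P] := INR_unbounded (4 / c1).
exists (n0 + n1 + 1) => n nn E E3 cE.
have n1R : (1 <= INR n)%R by apply: (le_INR 1); lia.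
have cn : (4 <= c1 * INR n)%R.
  have le_n : (INR n1 <= INR n)%R by apply: le_INR; lia.
  have -> : (4 = c1 * (4 / c1))%R by field; lra.
  by apply: Rmult_le_compat_l; lra.
have [/existsP[p /andP[/eqP p2 codeg]]|] :=
  boolP [exists p : {set 'I_n}, (#|p| == 2) && (e <= #|[set B in E | p \subset B]|)].
  by apply: has_config_le (config_of_codegree E3 p2 codeg); lia.
rewrite negb_exists => /forallP codeg.
have [|L [LE cL Llin]] := exists_linear_subsystem (e := e) E3.
  by move=> p p2; apply: ltnW; have := codeg p; rewrite p2 /= -ltnNge.
have L3 A : A \in L -> #|A| = 3 by move/(subsetP LE)/E3.
have [X [LX upX]] := glued_graph_dense L3 Llin.
pose G := glued_graph L.
have dense : (INR #|G| >= c1 * c1 / 8 * (INR n * INR n) * INR n)%R.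
  apply: (cubic_lower_bound (x := INR X)) => //.
    apply: Rle_trans (le_INR _ _ (elimT leP LX)).
    apply: (Rmult_le_reg_r (INR (3 * e))) => //.
    rewrite -(mult_INR #|L|); apply: Rle_trans (le_INR _ _ (elimT leP cL)).
    have -> : (c1 * (INR n * INR n) * INR (3 * e) = c * INR n ^ 2)%R.
      by rewrite /c1; field; lra.
    exact: Rge_le.
  have := le_INR _ _ (elimT leP upX).
  by rewrite card_ord !(mult_INR, plus_INR) /= => h; rewrite /G; lra.
pose G' := [set enum_rank @: (A : {set 'I_n * 'I_n}) | A in G].
have cT : #|{: 'I_n * 'I_n}| = n * n by rewrite card_prod card_ord.
have cG : #|G'| = #|G|.
  by rewrite card_imset //; apply: imset_inj; apply: enum_rank_inj.
have [|||H [HH Hc]] := copy #|{: 'I_n * 'I_n}| _ G'.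
- by rewrite cT; nia.
- move=> _ /imsetP[A GA ->]; rewrite card_imset; last exact: enum_rank_inj.
  exact: glued_graph_card L3 _ GA.
(* On [n * n] vertices the square root in the edge threshold is exactly [n]. *)
- rewrite cG cT mult_INR sqrt_square //; exact: pos_INR.
have [f fI fH] := contains_copy_finType Hc.
have kbig : (e + t) * (e + t) < k by rewrite /k; lia.
have [F [FL cF cov]] := exists_config_of_copy L3 Llin (ltnW (ltnW e3)) kbig HH fI fH.
by exists F; split; first exact: subset_trans LE.
Qed.
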